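(* Let $R \cong R_1\times\cdots\times R_r$ ($r\ge 1$) with finite commutative local rings $R_i$. Then the nullity of the zero-divisor graph $\Gamma(R)$ satisfies $$\eta(\Gamma(R)) \;\ge\; \prod_{i=1}^r \# R_i - \prod_{i=1}^r \# U(R_i) - \prod_{i=1}^r\big(\# V(\Gamma_E(R_i))+2\big) + 1 .$$
   Context: Rings are finite and commutative with $1\neq 0$; $U(R)$ is the set of units. The zero-divisor graph $\Gamma(R)$ has as vertex set $Z^*(R)$ the set of non-zero zero-divisors of $R$, and two (not necessarily distinct) vertices $x,y$ are adjacent iff $xy=0$; loops are kept, so the adjacency matrix $A(\Gamma(R))$ has diagonal entry $1$ at $x$ iff $x^2=0$. The nullity $\eta(G)$ of a graph $G$ is the multiplicity of the eigenvalue $0$ of its adjacency matrix $A(G)$, i.e. $\#V(G)-\operatorname{rank}A(G)$ (it is $0$ for the graph with no vertices). For $r\in R$ let $[r]_R=\{s\in R \mid \mathrm{ann}_R(r)=\mathrm{ann}_R(s)\}$, and let $R_E=\{[r]_R \mid r\in R\}$. The compressed zero-divisor graph $\Gamma_E(R)$ has vertex set $R_E\setminus\{[0]_R,[1]_R\}$, with $[x]_R,[y]_R$ adjacent iff $xy=0$. $\#S$ is the cardinality of a set $S$. *)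

(* Defs.v *)
From HB Require Import structures.
From mathcomp Require Import all_boot all_order all_algebra.

Set Implicit Arguments.
Unset Strict Implicit.
Unset Printing Implicit Defensive.

Import Order.TTheory GRing.Theory Num.Theory.
Local Open Scope ring_scope.

(* No irreflexivity is imposed: loops are kept. *)
Record graph := Graph { vertex :> finType; adjacent : rel vertex }.

Definition adjacency_matrix (G : graph) : 'M[rat]_#|G| :=
  \matrix_(i, j) (adjacent (enum_val i) (enum_val j))%:R.

(* The multiplicity of the eigenvalue 0 of a real symmetric matrix is its size
   minus its rank. The subtraction is never truncated, by rank_leq_row. *)
Definition nullity (G : graph) : nat := (#|G| - \rank (adjacency_matrix G))%N.

Section Rings.
Variable R : finComNzRingType.

Definition zero_divisor (x : R) : bool := [exists y : R, (y != 0) && (x * y == 0)].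

Definition zero_divisor_graph : graph :=
  @Graph {x : R | (x != 0) && zero_divisor x} (fun x y => val x * val y == 0).

Definition ann (r : R) : {set R} := [set s | r * s == 0].

Definition ann_class (r : R) : {set R} := [set s | ann r == ann s].

Definition ann_classes : {set {set R}} := [set ann_class r | r : R].

(* Whether x * y = 0 depends only on the classes of x and y, so it does not
   matter that adjacency is tested on some representatives. *)
Definition compressed_zero_divisor_graph : graph :=
  @Graph {X : {set R} | X \in ann_classes :\: [set ann_class 0; ann_class 1]}
    (fun X Y => [exists x in val X, exists y in val Y, x * y == 0]).

(* idealr_closed includes properness (1 is not in the ideal). *)
Definition maximal_ideal (M : {set R}) : Prop :=
  idealr_closed M /\
  forall I : {set R}, idealr_closed I -> M \subset I -> I = M.

Definition local_ring : Prop := exists! M : {set R}, maximal_ideal M.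

End Rings.

Definition unit_set (R : finComUnitRingType) : {set R} :=
  [set x | x \is a GRing.unit].

(* Dependent finite functions carry no ring structure in the library; the
   operations of the product ring are the componentwise ones. *)
Definition product_ring_iso (R : finComNzRingType) (I : finType)
    (S : I -> finComNzRingType) (f : R -> {dffun forall i, S i}) : Prop :=
  [/\ bijective f,
      forall i, f 1 i = 1,
      forall x y i, f (x + y) i = f x i + f y i
    & forall x y i, f (x * y) i = f x i * f y i].

(* Main.v *)
(** Two vertices of the zero-divisor graph with the same annihilator have the
    same row in the adjacency matrix, and in a product ring the annihilator is
    computed componentwise. So the rank is at most the number of tuples of
    annihilator classes of the factors, minus the two tuples of the classes of
    [0] and of [1], which no vertex attains. As a non-zero-divisor of a finite
    ring is a unit, there are #|R| - #|U(R)| - 1 vertices. *)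
Require Import Defs.
From HB Require Import structures.
From mathcomp Require Import all_boot all_order all_algebra.
From mathcomp Require Import zify.

Set Implicit Arguments.
Unset Strict Implicit.
Unset Printing Implicit Defensive.

Import Order.TTheory GRing.Theory Num.Theory.
Local Open Scope ring_scope.

(** Choosing one row for each key yields a matrix with [#|D|] rows whose row space contains every
    row of [A]. *)
Lemma mxrank_le_card_row_key (F : fieldType) (m n : nat) (A : 'M[F]_(m, n))
    (T : finType) (k : 'I_m -> T) (D : {set T}) :
  (forall i, k i \in D) -> (forall i j, k i = k j -> row i A = row j A) ->
  (\rank A <= #|D|)%N.
Proof.
move=> kD kA.
(* The default [0] fills the rows of the keys in [D] that no index attains. *)
pose C := \matrix_(d < #|D|)
  (if [pick i | k i == enum_val d] is Some i then row i A else 0).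
apply: leq_trans (mxrankS (_ : A <= C)%MS) (rank_leq_row C).
apply/row_subP => i; have -> : row i A = row (enum_rank_in (kD i) (k i)) C.
  rewrite rowK enum_rankK_in //; case: pickP => [j /eqP/esym/kA //|/(_ i)].
  by rewrite eqxx.
exact: row_sub.
Qed.

Lemma card_family_prod (I : finType) (T : I -> finType)
    (P : forall i, {set T i}) :
  #|[set g : {dffun forall i, T i} | [forall i, g i \in P i]]|
    = (\prod_i #|P i|)%N.
Proof.
rewrite cardsE -(big_image _ _ (fun i => #|P i|) _ id) -foldrE -card_family.
by apply: eq_card => g; apply/forallP/familyP.
Qed.

Section Ring.
Variable R : finComNzRingType.
Implicit Types x y : R.

Lemma ann_class_eq x y : ann_class x = ann_class y <-> ann x = ann y.
Proof.
split=> [/setP/(_ y)|xy]; last by apply/setP => z; rewrite !inE xy.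
by rewrite !inE eqxx => /eqP.
Qed.

Lemma ann_eq0 x : ann x = ann 0 -> x = 0.
Proof. by move/setP/(_ 1); rewrite !inE mulr1 mul0r eqxx => /eqP. Qed.

Lemma ann_eq1 x : ann x = ann 1 <-> ~~ zero_divisor x.
Proof.
split=> [xE | /existsPn xN].
  apply/existsPn => y; apply/negP => /andP[y0 xy].
  by move/setP/(_ y): xE; rewrite !inE mul1r xy (negPf y0).
apply/setP => y; rewrite !inE mul1r; apply/idP/eqP => [xy|->]; last
  exact/eqP/mulr0.
by apply: contraTeq xy => y0; have := xN y; rewrite y0.
Qed.

Lemma zero_divisor0 : zero_divisor (0 : R).
Proof. by apply/existsP; exists 1; rewrite oner_eq0 mul0r eqxx. Qed.

(** The classes of [0] and [1] removed from the vertex set are distinct because [1 != 0], so exactly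
    two are lost. *)
Lemma card_compressed_zero_divisor_graph :
  (#|compressed_zero_divisor_graph R| + 2 = #|ann_classes R|)%N.
Proof.
have class01 : ann_class 0 != ann_class (1 : R).
  by apply/eqP => /ann_class_eq/esym/ann_eq0/eqP; rewrite oner_eq0.
have sub01 : [set ann_class 0; ann_class 1] \subset ann_classes R.
  by apply/subsetP => X /set2P[] ->; apply: imset_f.
have card01 : #|[set ann_class 0; ann_class (1 : R)]| = 2%N.
  by rewrite cards2 class01.
rewrite /= card_sig -[RHS](subnK (subset_leq_card sub01)) card01.
congr (_ + 2)%N.
by rewrite -card01 -cardsDS //; apply: eq_card => X; rewrite inE.
Qed.

End Ring.

(** Multiplication by a non-zero-divisor is injective, hence bijective by finiteness, and the
    preimage of [1] is an inverse. *)
Lemma zero_divisor_unit (R : finComUnitRingType) (x : R) :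
  zero_divisor x = (x \isn't a GRing.unit).
Proof.
apply/idP/idP => [/existsP[y /andP[y0 /eqP xy]] | ].
  by apply: contra y0 => /mulrI; move/(_ y 0); rewrite xy mulr0 => ->.
apply: contraR => /existsPn xN.
have /injF_bij[g _ xg] : injective ( *%R x).
  move=> y z /eqP; rewrite -subr_eq0 -mulrBr => xyz; apply/eqP.
  rewrite -subr_eq0; apply: contraLR (xN (y - z)).
  by rewrite xyz andbT negbK => ->.
by apply/unitrP; exists (g 1); rewrite mulrC xg.
Qed.

Section Product.
Variables (R : finComNzRingType) (I : finType) (S : I -> finComNzRingType).
Variable f : R -> {dffun forall i, S i}.
Hypothesis f_iso : product_ring_iso f.
Implicit Types x y z : R.

Lemma iso0 i : f 0 i = 0.
Proof.
by case: f_iso => _ _ fD _; apply: (addrI (f 0 i)); rewrite -fD !addr0.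
Qed.

Lemma iso_eq0 x : (x == 0) = [forall i, f x i == 0].
Proof.
case: f_iso => /bij_inj f_inj _ _ _.
apply/eqP/forallP => [-> i|x0]; first by rewrite iso0.
by apply/f_inj/ffunP => i; rewrite iso0; apply/eqP.
Qed.

Lemma iso_mul_eq0 x y : (x * y == 0) = [forall i, f x i * f y i == 0].
Proof.
case: f_iso => _ _ _ fM; rewrite iso_eq0.
by apply: eq_forallb => i; rewrite fM.
Qed.

Lemma zero_divisor_iso x : zero_divisor x = [exists i, zero_divisor (f x i)].
Proof.
case: f_iso => -[g _ gK] _ _ _; apply/existsP/existsP => [[y /andP[y0 xy]]|].
  move: y0; rewrite iso_eq0 negb_forall => /existsP[i yi0]; exists i.
  apply/existsP; exists (f y i); rewrite yi0.
  by move: xy; rewrite iso_mul_eq0 => /forallP/(_ i).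
case=> i /existsP[z /andP[z0 xz]].
(* The witness has [z] at component [i] and [0] elsewhere: it is non-zero because of [z], and [x]
   kills it in every component. *)
pose y := g (finfun (dfwith (fun j => 0 : S j) z)).
have fy j : f y j = dfwith (fun j => 0 : S j) z j by rewrite gK ffunE.
exists y; rewrite iso_eq0 iso_mul_eq0 negb_forall; apply/andP; split.
  by apply/existsP; exists i; rewrite fy dfwith_in.
apply/forallP => j; rewrite fy; have [<-|ij] := eqVneq i j.
  by rewrite dfwith_in.
by rewrite dfwith_out // mulr0.
Qed.

(** This is the key for the rows of the adjacency matrix: it determines the annihilator of [x], and
    its possible values can be counted factor by factor. *)
Definition component_classes x : {dffun forall i, {set S i}} :=
  [ffun i => ann_class (f x i)].

Lemma component_classes_eq x y :
  component_classes x = component_classes y -> forall i, ann (f x i) = ann (f y i).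
Proof. by move=> xy i; apply/ann_class_eq; move/ffunP/(_ i): xy; rewrite !ffunE. Qed.

Lemma component_classes_mul_eq0 x y z :
  component_classes x = component_classes y -> (x * z == 0) = (y * z == 0).
Proof.
move=> /component_classes_eq xy; rewrite !iso_mul_eq0; apply: eq_forallb => i.
by have /setP/(_ (f z i)) := xy i; rewrite !inE.
Qed.

Lemma component_classes_eq0 x : component_classes x = component_classes 0 -> x = 0.
Proof.
(* Elements with equal keys are killed by the same [z]; here [z = 1]. *)
move=> /(component_classes_mul_eq0 1).
by rewrite mul0r mulr1 eqxx => /eqP.
Qed.

Lemma component_classes_eq1 x :
  component_classes x = component_classes 1 -> ~~ zero_divisor x.
Proof.
move=> /component_classes_mul_eq0 x1; apply/ann_eq1/setP => z.
by rewrite !inE x1.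
Qed.

Lemma rank_zero_divisor_graph :
  (\rank (adjacency_matrix (zero_divisor_graph R)) + 2
     <= \prod_i #|ann_classes (S i)|)%N.
Proof.
pose K := [set g : {dffun forall i, {set S i}} | [forall i, g i \in ann_classes (S i)]].
have cK x : component_classes x \in K.
  by rewrite inE; apply/forallP => i; rewrite ffunE imset_f.
pose B := [set component_classes 0; component_classes 1].
have BK : B \subset K by apply/subsetP => c /set2P[] ->.
have cardB : #|B| = 2%N.
  rewrite cards2; case: eqP => // /esym/component_classes_eq0/eqP.
  by rewrite oner_eq0.
rewrite -(card_family_prod (fun i => ann_classes (S i))) -/K.
rewrite -(subnK (subset_leq_card BK)) cardB leq_add2r -cardB -cardsDS //.
(* The keys of vertices lie in [K :\: B]: the key of [0] would force [x = 0], and that of [1] would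
   make [x] a non-zero-divisor. *)
apply: (@mxrank_le_card_row_key _ _ _ _ _
  (fun i => component_classes (val (enum_val i)))) => [i|i j ij].
  case: (enum_val i) => x /= /andP[x0 zx]; rewrite in_setD cK andbT in_set2.
  apply/norP; split; apply/eqP.
    by move/component_classes_eq0/eqP; apply/negP.
  by move/component_classes_eq1; rewrite zx.
by apply/rowP => k; rewrite !mxE /= (component_classes_mul_eq0 _ ij).
Qed.

Lemma card_product_ring : #|R| = (\prod_i #|S i|)%N.
Proof.
case: f_iso => f_bij _ _ _; rewrite (bij_eq_card f_bij) card_dep_ffun foldrE.
by rewrite (big_image _ _ _ _ id).
Qed.

(** By [zero_divisor_iso], [f] matches the non-zero-divisors of [R] with the tuples of
    non-zero-divisors. *)
Lemma card_non_zero_divisors :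
  #|[set x : R | ~~ zero_divisor x]|
    = (\prod_i #|[set y : S i | ~~ zero_divisor y]|)%N.
Proof.
case: f_iso => f_bij _ _ _; rewrite -card_family_prod.
rewrite -(on_card_preimset (onW_bij _ f_bij)); apply: eq_card => x.
by rewrite !inE zero_divisor_iso negb_exists; apply: eq_forallb => i; rewrite inE.
Qed.

End Product.

(** The summand [1] accounts for [0], which satisfies [zero_divisor] but is not a vertex. *)
Lemma card_zero_divisor_graph (R : finComNzRingType) :
  (#|zero_divisor_graph R| + #|[set x : R | ~~ zero_divisor x]| + 1 = #|R|)%N.
Proof.
rewrite /= card_sig -(cardsC [set x : R | zero_divisor x]).
rewrite (cardsD1 0 [set x | zero_divisor x]) inE zero_divisor0 addn1.
by congr (_ + _).+1; apply: eq_card => x; rewrite !inE.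
Qed.

Theorem theorem3p5 (r : nat) (r_ge1 : (1 <= r)%N)
    (R : finComNzRingType) (S : 'I_r -> finComUnitRingType)
    (S_local : forall i, local_ring (S i))
    (f : R -> {dffun forall i, S i})
    (f_iso : product_ring_iso (S := fun i => S i : finComNzRingType) f) :
  (nullity (zero_divisor_graph R))%:Z >=
    (\prod_(i < r) #|S i|)%N%:Z
    - (\prod_(i < r) #|unit_set (S i)|)%N%:Z
    - (\prod_(i < r) (#|compressed_zero_divisor_graph (S i)| + 2))%N%:Z
    + 1.
Proof.
have units i : #|[set y : S i | ~~ zero_divisor y]| = #|unit_set (S i)|.
  by apply: eq_card => y; rewrite !inE zero_divisor_unit negbK.
have := rank_zero_divisor_graph f_iso; have := card_zero_divisor_graph R.
rewrite (card_product_ring f_iso) (card_non_zero_divisors f_iso) /nullity.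
rewrite (eq_bigr _ (fun i _ => units i)).
rewrite -(eq_bigr _ (fun i _ => card_compressed_zero_divisor_graph (S i))).
have := rank_leq_row (adjacency_matrix (zero_divisor_graph R)).
set p := (\prod_(i < r) #|S i|)%N; set u := (\prod_(i < r) #|unit_set _|)%N.
(* With [n] vertices and rank [k], the facts at hand are [n + u + 1 = p] and [k + 2 <= c], whence
   [n - k >= p - u - c + 1]. *)
set c := (\prod_(i < r) (_ + 2))%N; move: p u c #|zero_divisor_graph R| (\rank _); lia.
Qed.
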